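(* Let $\mathcal U=\{u\in\mathbb R^m:\ u_{k,\min}\le u_k\le u_{k,\max},\ k=1,\dots,m\}$ be a box, and let $u^1,\dots,u^N\in\mathcal U$ be vertex-feasible inputs, i.e. $\Psi(x^j)u^j+\delta(x^j)\ge 0$ for $j=1,\dots,N$. Assume that $\delta:H\to\mathbb R^p$ is concave, that each column map $\Psi_{:,k}(\cdot):H\to\mathbb R^p$ is concave, convex, or affine on $H$, and that each column is sign-coherent at the vertices: for every $k\in\{1,\dots,m\}$ and every $j\in\{1,\dots,N\}$, either $\Psi_{:,k}(x^j)\ge 0$ or $\Psi_{:,k}(x^j)\le 0$ (entrywise). For each $k$ let $$\mathcal P_k=\{j:\Psi_{:,k}(x^j)\ge 0\},\qquad \mathcal N_k=\{j:\Psi_{:,k}(x^j)\le 0\},$$ $$L_k=\max_{j\in\mathcal P_k}(u^j)_k,\qquad U_k=\min_{j\in\mathcal N_k}(u^j)_k,$$ with $L_k=-\infty$ if $\mathcal P_k=\emptyset$ and $U_k=+\infty$ if $\mathcal N_k=\emptyset$, and let $$I_k=[\max\{L_k,u_{k,\min}\},\ \min\{U_k,u_{k,\max}\}],\qquad \tilde I_k=I_k\cap\mathcal S_k(\Psi).$$ If $\tilde I_k$ is nonempty for all $k=1,\dots,m$, then any $u\in\mathbb R^m$ with $u_k\in\tilde I_k$ for all $k$ satisfies $\Psi(x)u+\delta(x)\ge 0$ for all $x\in H$.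
   Context: Setting. Consider the control-affine system $\dot x=f(x)+g(x)u$ with $x\in\mathcal X\subseteq\mathbb R^n$, $u\in\mathcal U\subseteq\mathbb R^m$, where $f:\mathbb R^n\to\mathbb R^n$ and $g:\mathbb R^n\to\mathbb R^{n\times m}$ are locally Lipschitz and $\mathcal U$ is nonempty, compact and convex. Let $h_1,\dots,h_p:\mathcal X\to\mathbb R$ be $C^1$ and let $\alpha_1,\dots,\alpha_p$ be extended class-$\mathcal K_\infty$ functions (continuous, strictly increasing bijections $\mathbb R\to\mathbb R$ with $\alpha_i(0)=0$). With $\nabla h_i(x)$ the gradient as a row vector, put $L_fh_i(x)=\nabla h_i(x)f(x)\in\mathbb R$ and $L_gh_i(x)=\nabla h_i(x)g(x)\in\mathbb R^{1\times m}$. Let $\Psi(x)\in\mathbb R^{p\times m}$ be the matrix whose $i$th row is $L_gh_i(x)$, and let $\delta(x)\in\mathbb R^p$ have entries $\delta_i(x)=L_fh_i(x)+\alpha_i(h_i(x))$. The stacked control barrier function inequalities at $x$ are $\Psi(x)u+\delta(x)\ge 0$. Points $x^1,\dots,x^N\in\mathcal X$ (''vertices'') are given with convex hull $H=\mathrm{co}\{x^1,\dots,x^N\}\subseteq\mathcal X$. Conventions. Vector inequalities are componentwise; concavity/convexity of vector-valued maps is componentwise. $\Psi_{:,k}$ is the $k$th column of $\Psi$, and $(u)_k=u_k$ is the $k$th coordinate of $u$. When every column map $\Psi_{:,k}(\cdot)$ is concave, convex or affine on $H$, define for each $k$: $\mathcal S_k(\Psi)=\mathbb R$ if $\Psi_{:,k}$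 is affine on $H$ (this case takes precedence); otherwise $\mathcal S_k(\Psi)=[0,\infty)$ if $\Psi_{:,k}$ is concave on $H$ and $\mathcal S_k(\Psi)=(-\infty,0]$ if $\Psi_{:,k}$ is convex on $H$. An interval $[a,b]$ with $a>b$ is empty. *)

(* Defs.v *)
(* Points of R^n are column vectors ['cV[R]_n]; gradients are row vectors. *)
From HB Require Import structures.
From mathcomp Require Import all_boot all_order all_algebra.
From mathcomp Require Import all_classical all_reals all_analysis.

Set Implicit Arguments.
Unset Strict Implicit.
Unset Printing Implicit Defensive.

Import Order.TTheory GRing.Theory Num.Theory.
Import numFieldNormedType.Exports.

Local Open Scope classical_set_scope.
Local Open Scope ring_scope.
Local Open Scope convex_scope.

Definition nonneg_vec (R : realType) (p : nat) (v : 'cV[R]_p) : bool :=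
  [forall i, 0 <= v i 0].

Definition nonpos_vec (R : realType) (p : nat) (v : 'cV[R]_p) : bool :=
  [forall i, v i 0 <= 0].

Definition convex_hull (R : realType) (n : nat) (A : set 'cV[R]_n) :
    set 'cV[R]_n :=
  smallest (@convex_set R 'cV[R]_n) A.

Definition convex_map (R : realType) (n p : nat) (D : set 'cV[R]_n)
    (F : 'cV[R]_n -> 'cV[R]_p) : Prop :=
  forall i, convex_function D (fun x => F x i 0).

Definition concave_map (R : realType) (n p : nat) (D : set 'cV[R]_n)
    (F : 'cV[R]_n -> 'cV[R]_p) : Prop :=
  convex_map D (fun x => - F x).

Definition affine_map (R : realType) (n p : nat) (D : set 'cV[R]_n)
    (F : 'cV[R]_n -> 'cV[R]_p) : Prop :=
  forall t : {i01 R},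
    {in D &, forall x y : convex_lmodType 'cV[R]_n,
      F (x <| t |> y) =
        (F x : convex_lmodType 'cV[R]_p) <| t |> F y}.

Definition locally_lipschitz (R : realType) (V W : normedModType R)
    (f : V -> W) : Prop :=
  forall x : V, exists2 A, nbhs x A & [lipschitz f y | y in A].

Definition ext_class_Kinfty (R : realType) (a : R -> R) : Prop :=
  [/\ continuous a, {homo a : s t / s < t}, bijective a & a 0 = 0].

Definition grad (R : realType) (n : nat) (h : 'cV[R]_n -> R) (x : 'cV[R]_n) :
    'rV[R]_n :=
  \row_j 'D_(delta_mx j 0) h x.

(* [A] need not be open: being C^1 on [A] means being C^1 on an open set
   containing [A], so that the gradient is defined at every point of [A]. *)
Definition C1_on (R : realType) (n : nat) (A : set 'cV[R]_n)
    (h : 'cV[R]_n -> R) : Prop :=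
  exists B : set 'cV[R]_n,
    [/\ open B, A `<=` B, {in B, forall x, differentiable h x}
      & {in B, continuous (grad h)}].

Definition Lie_f (R : realType) (n : nat) (f : 'cV[R]_n -> 'cV[R]_n)
    (h : 'cV[R]_n -> R) (x : 'cV[R]_n) : R :=
  (grad h x *m f x) 0 0.

Definition Lie_g (R : realType) (n m : nat) (g : 'cV[R]_n -> 'M[R]_(n, m))
    (h : 'cV[R]_n -> R) (x : 'cV[R]_n) : 'rV[R]_m :=
  grad h x *m g x.

Definition Psi (R : realType) (n m p : nat) (g : 'cV[R]_n -> 'M[R]_(n, m))
    (h : 'I_p -> 'cV[R]_n -> R) (x : 'cV[R]_n) : 'M[R]_(p, m) :=
  \matrix_(i < p) Lie_g g (h i) x.

Definition delta (R : realType) (n p : nat) (f : 'cV[R]_n -> 'cV[R]_n)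
    (h : 'I_p -> 'cV[R]_n -> R) (alpha : 'I_p -> R -> R) (x : 'cV[R]_n) :
    'cV[R]_p :=
  \col_i (Lie_f f (h i) x + alpha i (h i x)).

Definition box (R : realType) (m : nat) (umin umax : 'cV[R]_m) :
    set 'cV[R]_m :=
  [set u | forall k, umin k 0 <= u k 0 <= umax k 0].

(* The final [set0] is a junk value: the set is only meaningful for [F]
   affine, concave or convex on [H]. *)
Definition sign_set (R : realType) (n p : nat) (H : set 'cV[R]_n)
    (F : 'cV[R]_n -> 'cV[R]_p) : set R :=
  if `[< affine_map H F >] then setT
  else if `[< concave_map H F >] then [set v | 0 <= v]
  else if `[< convex_map H F >] then [set v | v <= 0]
  else set0.

Definition pos_idx (R : realType) (n m p N : nat)
    (M : 'cV[R]_n -> 'M[R]_(p, m)) (x : 'I_N -> 'cV[R]_n) (k : 'I_m) :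
    pred 'I_N :=
  fun j => nonneg_vec (col k (M (x j))).

Definition neg_idx (R : realType) (n m p N : nat)
    (M : 'cV[R]_n -> 'M[R]_(p, m)) (x : 'I_N -> 'cV[R]_n) (k : 'I_m) :
    pred 'I_N :=
  fun j => nonpos_vec (col k (M (x j))).

Definition Lbound (R : realType) (n m p N : nat)
    (M : 'cV[R]_n -> 'M[R]_(p, m)) (x : 'I_N -> 'cV[R]_n)
    (uv : 'I_N -> 'cV[R]_m) (k : 'I_m) : \bar R :=
  (\big[maxe/-oo]_(j < N | pos_idx M x k j) (uv j k 0)%:E)%E.

Definition Ubound (R : realType) (n m p N : nat)
    (M : 'cV[R]_n -> 'M[R]_(p, m)) (x : 'I_N -> 'cV[R]_n)
    (uv : 'I_N -> 'cV[R]_m) (k : 'I_m) : \bar R :=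
  (\big[mine/+oo]_(j < N | neg_idx M x k j) (uv j k 0)%:E)%E.

Definition I_set (R : realType) (n m p N : nat)
    (M : 'cV[R]_n -> 'M[R]_(p, m)) (umin umax : 'cV[R]_m)
    (x : 'I_N -> 'cV[R]_n) (uv : 'I_N -> 'cV[R]_m) (k : 'I_m) : set R :=
  [set v | (maxe (Lbound M x uv k) (umin k 0)%:E <= v%:E
              <= mine (Ubound M x uv k) (umax k 0)%:E)%E].

Definition I_tilde (R : realType) (n m p N : nat)
    (M : 'cV[R]_n -> 'M[R]_(p, m)) (umin umax : 'cV[R]_m)
    (x : 'I_N -> 'cV[R]_n) (uv : 'I_N -> 'cV[R]_m) (k : 'I_m) : set R :=
  I_set M umin umax x uv k `&`
  sign_set (convex_hull (range x)) (fun y => col k (M y)).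

(* Main.v *)
(* Since u_k lies in S_k, every map u_k Psi_{:,k} is concave on H whatever the
   curvature of the column, so each row of Psi u + delta is concave on H, and it
   suffices to check the vertices.  There, u_k - (u^j)_k has the sign of column k
   at x^j, so replacing u^j by u can only increase Psi(x^j) u^j. *)
Require Import Defs.
From mathcomp Require Import all_boot all_order all_algebra.
From mathcomp Require Import all_classical all_reals all_analysis.
From mathcomp Require Import ring.
Import Order.TTheory GRing.Theory Num.Theory.
Import numFieldNormedType.Exports.
Local Open Scope classical_set_scope.
Local Open Scope ring_scope.

Local Open Scope convex_scope.

(** An intersection of convex sets is convex, and [smallest] is such an intersection. *)
Lemma convex_hull_convex (R : realType) (n : nat) (A : set 'cV[R]_n) :
  convex_set (convex_hull A).
Proof.
move=> y z t; rewrite !inE => yA zA B [cB AB].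
by have := cB y z t; rewrite !inE; apply; [exact: yA | exact: zA].
Qed.

(** Reduces a bound on the hull to its generators. Since [F] is convex only on the hull, the
    sublevel set is cut down to the hull; the result is a convex set containing [A], so minimality
    of the hull applies. *)
Lemma convex_hull_sublevel (R : realType) (n : nat) (A : set 'cV[R]_n)
    (F : 'cV[R]_n -> R) (c : R) :
  convex_function (convex_hull A) F -> (forall y, A y -> F y <= c) ->
  forall y, convex_hull A y -> F y <= c.
Proof.
move=> cF AF.
suff sub : convex_hull A `<=` [set y | convex_hull A y /\ F y <= c].
  by move=> y /sub[].
apply: smallest_sub; last first.
  by move=> y Ay; split; [exact: sub_gen_smallest | exact: AF].
move=> y z t; rewrite !inE => -[Hy Fy] [Hz Fz]; split.
  by have := @convex_hull_convex _ _ A y z t; rewrite !inE; apply.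
have /= Fyz := cF t y z (mem_set Hy) (mem_set Hz).
apply: (le_trans Fyz); rewrite convRE.
(* Splitting [c] with the same weights allows a termwise comparison. *)
have -> : c = t%:num * c + (1 - t%:num) * c by ring.
by apply: lerD; apply: ler_wpM2l => //=; rewrite subr_ge0.
Qed.

Lemma convex_functionD (R : realType) (n : nat) (D : set 'cV[R]_n)
    (F G : 'cV[R]_n -> R) :
  convex_function D F -> convex_function D G ->
  convex_function D (fun y => F y + G y).
Proof.
move=> cF cG t y z yD zD; have := lerD (cF t y z yD zD) (cG t y z yD zD).
by rewrite !convRE !mulrDr addrACA.
Qed.

Lemma convex_function_sum (R : realType) (n m : nat) (D : set 'cV[R]_n)
    (F : 'I_m -> 'cV[R]_n -> R) :
  (forall k, convex_function D (F k)) ->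
  convex_function D (fun y => \sum_k F k y).
Proof.
move=> cF t y z yD zD; rewrite convRE !mulr_sumr -big_split/=.
by apply: ler_sum => k _; have := cF k t y z yD zD; rewrite convRE.
Qed.

(** A factor [v >= 0] preserves concavity, a factor [v <= 0] turns convexity into concavity, and an
    affine map stays affine, hence concave, under any factor. In the junk case [set0] there is no
    [v]. *)
Lemma sign_set_concave_scale (R : realType) (n p : nat) (D : set 'cV[R]_n)
    (F : 'cV[R]_n -> 'cV[R]_p) (v : R) :
  sign_set D F v -> concave_map D (fun y => v *: F y).
Proof.
rewrite /sign_set; case: asboolP => [aF _|_].
  move=> i t y z yD zD; rewrite (aF t y z yD zD) convRE !mxE.
  by rewrite le_eqVlt; apply/orP; left; apply/eqP; ring.
case: asboolP => [cF v0|_].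
  move=> i t y z yD zD; have := ler_wpM2l v0 (cF i t y z yD zD).
  by rewrite !convRE !mxE !mulrN !mulrDr !mulrN !(mulrCA v).
case: asboolP => [cF v0|_ //].
move=> i t y z yD zD; have := ler_wnM2l v0 (cF i t y z yD zD).
by rewrite !convRE !mxE !mulrN mulrDr !(mulrCA v) -opprD lerN2.
Qed.

(** If column [k] is nonnegative at [x j], then [uv j k 0] enters the maximum [Lbound], so it is at
    most [v]. If the column is nonpositive, it enters the minimum [Ubound], so it is at least [v],
    and the nonpositive entry reverses the order. *)
Lemma I_set_mono_at_vertex (R : realType) (n m p N : nat)
    (M : 'cV[R]_n -> 'M[R]_(p, m)) (umin umax : 'cV[R]_m)
    (x : 'I_N -> 'cV[R]_n) (uv : 'I_N -> 'cV[R]_m) (k : 'I_m) (v : R)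
    (j : 'I_N) (i : 'I_p) :
  nonneg_vec (col k (M (x j))) \/ nonpos_vec (col k (M (x j))) ->
  I_set M umin umax x uv k v ->
  M (x j) i k * uv j k 0 <= M (x j) i k * v.
Proof.
rewrite /I_set/= ge_max le_min => sgn /andP[/andP[Lv _] /andP[vU _]].
case: sgn => s; have := forallP s i; rewrite mxE => si.
  apply: ler_wpM2l => //; rewrite -lee_fin; apply: le_trans Lv.
  exact: (le_bigmax_cond _ (fun j => (uv j k 0)%:E)).
apply: ler_wnM2l => //; rewrite -lee_fin; apply: (le_trans vU).
exact: (bigmin_le_cond _ (fun j => (uv j k 0)%:E)).
Qed.

Theorem theorem1 (R : realType) (n m p N : nat)
  (X : set 'cV[R]_n) (U : set 'cV[R]_m)
  (f : 'cV[R]_n -> 'cV[R]_n) (g : 'cV[R]_n -> 'M[R]_(n, m))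
  (hf : locally_lipschitz f) (hg : locally_lipschitz g)
  (hU0 : U !=set0) (hUcompact : compact U) (hUconvex : convex_set U)
  (h : 'I_p -> 'cV[R]_n -> R) (hh : forall i, C1_on X (h i))
  (alpha : 'I_p -> R -> R) (halpha : forall i, ext_class_Kinfty (alpha i))
  (x : 'I_N -> 'cV[R]_n) (hxX : forall j, X (x j))
  (hHX : convex_hull (range x) `<=` X)
  (umin umax : 'cV[R]_m) (hUbox : U = box umin umax)
  (uv : 'I_N -> 'cV[R]_m) (huvU : forall j, U (uv j))
  (huv : forall j, nonneg_vec (Psi g h (x j) *m uv j + delta f h alpha (x j)))
  (hdelta : concave_map (convex_hull (range x)) (delta f h alpha))
  (hPsi : forall k : 'I_m,
    [\/ concave_map (convex_hull (range x)) (fun y => col k (Psi g h y)),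
        convex_map (convex_hull (range x)) (fun y => col k (Psi g h y))
      | affine_map (convex_hull (range x)) (fun y => col k (Psi g h y))])
  (hsign : forall (k : 'I_m) (j : 'I_N),
    nonneg_vec (col k (Psi g h (x j))) \/ nonpos_vec (col k (Psi g h (x j))))
  (hI : forall k, I_tilde (Psi g h) umin umax x uv k !=set0) :
  forall u : 'cV[R]_m,
    (forall k, I_tilde (Psi g h) umin umax x uv k (u k 0)) ->
    forall y, convex_hull (range x) y ->
      nonneg_vec (Psi g h y *m u + delta f h alpha y).
Proof.
move=> u hu y Hy; apply/forallP => i; rewrite -oppr_le0; move: y Hy.
(* [F] is row [i] with its sign reversed: the goal becomes [F <= 0], and concavity of each term
   becomes convexity of [G k], in the very form that [concave_map] unfolds to. *)
pose G k z := (- (u k 0 *: col k (Psi g h z))) i 0.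
pose F z := \sum_k G k z + (- delta f h alpha z) i 0.
have FE z : - (Psi g h z *m u + delta f h alpha z) i 0 = F z.
  rewrite /F [in LHS]mxE [X in X + _]mxE opprD -sumrN [X in _ = _ + X]mxE.
  by congr (_ + _); apply: eq_bigr => k _; rewrite /G !mxE mulrC.
move=> y Hy; rewrite FE; move: y Hy; apply: convex_hull_sublevel.
  apply: convex_functionD; last exact: hdelta.
  by apply: convex_function_sum => k; apply: sign_set_concave_scale; case: (hu k).
move=> _ [j _ <-]; rewrite -FE oppr_le0.
(* Vertex feasibility of [uv j] gives the lower bound 0; the common [delta] term then cancels and
   the sums are compared column by column. *)
apply: le_trans (forallP (huv j) i) _.
rewrite 2!mxE [leRHS]mxE [X in _ <= X + _]mxE lerD2r.
by apply: ler_sum => k _; case: (hu k) => [/I_set_mono_at_vertex + _]; apply.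
Qed.
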